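(* Let $A$ be an antichain in $R^+$ and $k\ge1$. The ideal $\Phi(A)$ is of nilpotence $k$ if and only if for all $\beta_1,\dots,\beta_{k+1}\in A$ (not necessarily distinct) we have $\sum_{s=1}^{k+1}\beta_s\not\le\theta$.
   Context: $\mathfrak g$ is a complex simple Lie algebra with root system $R$, simple roots $\{\alpha_i\}_{i\in I}$, $Q^+$ the $\mathbb Z_{\ge0}$-span of the simple roots, $R^+=R\cap Q^+$, partial order $\lambda\le\mu$ iff $\mu-\lambda\in Q^+$, and $\theta$ the highest root. An antichain is a subset $A\subseteq R^+$ whose distinct elements are pairwise incomparable for $\le$. $\Phi(A)=\{\alpha\in R^+:\alpha\ge\beta\text{ for some }\beta\in A\}$. A subset $\Phi\subseteq R^+$ is of nilpotence $k$ if for any $\beta_1,\dots,\beta_{k+1}\in\Phi$ (not necessarily distinct) we have $\sum_{p=1}^{k+1}\beta_p\notin R$. *)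

(* Defs.v *)
(* Root systems of complex simple Lie algebras are encoded
   through their (indecomposable, finite type) Cartan matrices; roots are
   written in coordinates w.r.t. the simple roots, as row vectors of integers. *)
From HB Require Import structures.
From mathcomp Require Import all_boot all_order all_algebra.
Set Implicit Arguments. Unset Strict Implicit. Unset Printing Implicit Defensive.
Import Order.TTheory GRing.Theory Num.Theory.
Local Open Scope ring_scope.

(* Generalized Cartan matrix: a_ii = 2, a_ij <= 0 (i<>j), a_ij = 0 <-> a_ji = 0.
   Convention (Kac): a_ij = <alpha_j, alpha_i^vee>. *)
Definition gen_cartan (n : nat) (C : 'M[int]_n) : Prop :=
  [/\ forall i, C i i = 2,
      forall i j, i != j -> C i j <= 0
    & forall i j, C i j = 0 <-> C j i = 0].

Definition indecomposable (n : nat) (C : 'M[int]_n) : Prop :=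
  forall S : {set 'I_n}, S != set0 -> S != setT ->
    exists i j, [/\ i \in S, j \notin S & C i j != 0].

Definition finite_type (n : nat) (C : 'M[int]_n) : Prop :=
  exists d : 'I_n -> int,
    [/\ forall i, 0 < d i,
        forall i j, d i * C i j = d j * C j i
      & forall x : 'I_n -> rat, (exists i, x i != 0) ->
          0 < \sum_i \sum_j x i * (d i * C i j)%:~R * x j].

Definition simple_cartan (n : nat) (C : 'M[int]_n) : Prop :=
  [/\ (0 < n)%N, gen_cartan C, indecomposable C & finite_type C].

Definition sroot (n : nat) (i : 'I_n) : 'rV[int]_n := delta_mx 0 i.

(* simple reflection s_i(v) = v - <v, alpha_i^vee> alpha_i *)
Definition srefl (n : nat) (C : 'M[int]_n) (i : 'I_n) (v : 'rV[int]_n) : 'rV[int]_n :=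
  v - (\sum_j v 0 j * C i j) *: sroot i.

(* root system R = Weyl group orbit of the simple roots *)
Inductive is_root (n : nat) (C : 'M[int]_n) : 'rV[int]_n -> Prop :=
| root_simple i : is_root C (sroot i)
| root_refl i v : is_root C v -> is_root C (srefl C i v).

(* lambda <= mu iff mu - lambda in Q^+ *)
Definition leR (n : nat) (u v : 'rV[int]_n) : Prop := forall i, u 0 i <= v 0 i.

Definition pos_root (n : nat) (C : 'M[int]_n) (v : 'rV[int]_n) : Prop :=
  is_root C v /\ leR 0 v.

Definition highest_root (n : nat) (C : 'M[int]_n) (t : 'rV[int]_n) : Prop :=
  pos_root C t /\ forall a, pos_root C a -> leR a t.

Definition antichain (n : nat) (C : 'M[int]_n) (A : 'rV[int]_n -> Prop) : Prop :=
  (forall a, A a -> pos_root C a) /\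
  (forall a b, A a -> A b -> a <> b -> ~ leR a b).

Definition PhiI (n : nat) (C : 'M[int]_n) (A : 'rV[int]_n -> Prop) (a : 'rV[int]_n) : Prop :=
  pos_root C a /\ exists b, A b /\ leR b a.

Definition nilpotence (n : nat) (C : 'M[int]_n) (P : 'rV[int]_n -> Prop) (k : nat) : Prop :=
  forall b : 'I_k.+1 -> 'rV[int]_n, (forall p, P (b p)) -> ~ is_root C (\sum_p b p).

(* Main.v *)
(* One direction is monotonicity.  The other follows from the claim that, if
   positive roots b_p and a root g satisfy sum b_p <= g, then the b_p can be
   enlarged to positive roots whose sum is a root.  Induct on the height of mu = g - sum b_p.  If mu <> 0 then
   (mu, mu) > 0 gives a simple root alpha_i in the support of mu with
   (mu, alpha_i) > 0, so either (g, alpha_i) > 0 and g can be replaced by the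
   root g - alpha_i, or (b_p, alpha_i) < 0 for some p and b_p can be replaced by
   the root b_p + alpha_i. *)
Require Import Defs.
From HB Require Import structures.
From mathcomp Require Import all_boot all_order all_algebra.
From mathcomp Require Import zify ring.
Import Order.TTheory GRing.Theory Num.Theory.
Local Open Scope ring_scope.

(** The conditions of [finite_type] on a fixed [d], so that all lemmas share one form. *)
Definition symmetrizer (n : nat) (C : 'M[int]_n) (d : 'I_n -> int) : Prop :=
  [/\ forall i, 0 < d i,
      forall i j, d i * C i j = d j * C j i
    & forall x : 'I_n -> rat, (exists i, x i != 0) ->
        0 < \sum_i \sum_j x i * (d i * C i j)%:~R * x j].

(** For a symmetrizer [d] of a Cartan matrix, the Weyl-invariant form normalized by (alpha_i,
    alpha_i) = 2 d_i. *)
Definition form (n : nat) (C : 'M[int]_n) (d : 'I_n -> int)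
    (u v : 'rV[int]_n) : int :=
  (u *m (\matrix_(i, j) (d i * C i j)) *m v^T) 0 0.

Definition coroot_pairing (n : nat) (C : 'M[int]_n) (i : 'I_n)
    (v : 'rV[int]_n) : int := \sum_j v 0 j * C i j.

Lemma formDl n (C : 'M[int]_n) d u v w :
  form n C d (u + v) w = form n C d u w + form n C d v w.
Proof. by rewrite /form !mulmxDl mxE. Qed.

Lemma formZl n (C : 'M[int]_n) d a u w :
  form n C d (a *: u) w = a * form n C d u w.
Proof. by rewrite /form -!scalemxAl mxE. Qed.

Lemma formDr n (C : 'M[int]_n) d u v w :
  form n C d w (u + v) = form n C d w u + form n C d w v.
Proof. by rewrite /form linearD mulmxDr mxE. Qed.

Lemma formZr n (C : 'M[int]_n) d a u w :
  form n C d w (a *: u) = a * form n C d w u.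
Proof. by rewrite /form linearZ -scalemxAr mxE. Qed.

Lemma formNl n (C : 'M[int]_n) d u w :
  form n C d (- u) w = - form n C d u w.
Proof. by rewrite -scaleN1r formZl mulN1r. Qed.

Lemma formNr n (C : 'M[int]_n) d u w :
  form n C d w (- u) = - form n C d w u.
Proof. by rewrite -scaleN1r formZr mulN1r. Qed.

Lemma form_suml n (C : 'M[int]_n) d (I : finType) (b : I -> 'rV[int]_n) w :
  form n C d (\sum_p b p) w = \sum_p form n C d (b p) w.
Proof. by rewrite /form !mulmx_suml summxE. Qed.

Lemma formE n (C : 'M[int]_n) d u v :
  form n C d u v = \sum_i \sum_j u 0 i * (d i * C i j) * v 0 j.
Proof.
rewrite /form mxE exchange_big /=; apply: eq_bigr => j _.
by rewrite !mxE mulr_suml; apply: eq_bigr => i _; rewrite !mxE.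
Qed.

Section Form.
Context (n : nat) (C : 'M[int]_n) (d : 'I_n -> int).
Hypotheses (C2 : forall i, C i i = 2) (symC : symmetrizer n C d).

Local Notation form := (form n C d).
Local Notation pairing := (coroot_pairing n C).

Lemma formC u v : form u v = form v u.
Proof.
case: symC => _ sym _; rewrite !formE exchange_big /=.
apply: eq_bigr => i _; apply: eq_bigr => j _.
by rewrite sym; ring.
Qed.

Lemma form_gt0 u : u != 0 -> 0 < form u u.
Proof.
case: symC => _ _ pos /rV0Pn [i ui]; rewrite -(ltr0z rat).
have -> : (form u u)%:~R = \sum_i \sum_j
    (u 0 i)%:~R * (d i * C i j)%:~R * (u 0 j)%:~R :> rat.
  rewrite formE rmorph_sum; apply: eq_bigr => j _; rewrite rmorph_sum.
  by apply: eq_bigr => l _; rewrite 2!rmorphM.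
by apply: (pos (fun i => (u 0 i)%:~R)); exists i; rewrite intr_eq0.
Qed.

Lemma form_sroot v i : form v (sroot i) = d i * pairing i v.
Proof.
case: symC => _ sym _; rewrite formE /coroot_pairing mulr_sumr.
apply: eq_bigr => j _; rewrite (bigD1 i) //= big1 => [|l /negPf il].
  by rewrite mxE !eqxx mulr1 addr0 sym mulrCA.
by rewrite mxE il andbF mulr0.
Qed.

Lemma pairing_sroot i : pairing i (sroot i) = 2.
Proof.
rewrite /coroot_pairing (bigD1 i) //= big1 => [|l /negPf il].
  by rewrite mxE !eqxx mul1r addr0 C2.
by rewrite mxE il andbF mul0r.
Qed.

Lemma pairingB i u a v : pairing i (u - a *: v) = pairing i u - a * pairing i v.
Proof.
rewrite /coroot_pairing mulr_sumr -sumrB; apply: eq_bigr => j _.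
by rewrite !mxE mulrBl mulrA.
Qed.

Lemma sreflB i u a v :
  srefl C i (u - a *: v) = srefl C i u - a *: srefl C i v.
Proof.
rewrite /srefl -!/(coroot_pairing _ _ _ _) pairingB.
by apply/rowP => j; rewrite !mxE; ring.
Qed.

Lemma sreflK i : involutive (srefl C i).
Proof.
move=> v; rewrite /srefl -!/(coroot_pairing _ _ _ _) pairingB pairing_sroot.
by apply/rowP => j; rewrite !mxE; ring.
Qed.

(** The correction terms cancel because (alpha_i, alpha_i) = 2 d_i. *)
Lemma form_srefl i u v : form (srefl C i u) (srefl C i v) = form u v.
Proof.
rewrite /srefl -!/(coroot_pairing _ _ _ _) !(formDl, formDr, formNl, formNr).
rewrite !(formZl, formZr) !form_sroot [form (sroot i) _]formC form_sroot.
by rewrite pairing_sroot; ring.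
Qed.

(** Each s_i is an involution fixing 0, so it cannot send a nonzero vector to 0. *)
Lemma root_neq0 v : is_root C v -> v != 0.
Proof.
elim=> [i|i {}v _]; first by apply/rV0Pn; exists i; rewrite mxE !eqxx.
apply: contra_neq => v0; rewrite -(sreflK i v) v0 /srefl.
by rewrite big1 ?scale0r ?subr0 // => j _; rewrite mxE mul0r.
Qed.

(* The function [f] is the coroot of [b]; since [b] is a Weyl group translate
   of a simple root, its reflection is a conjugate of a simple one. *)
Lemma root_reflection b : is_root C b ->
  exists f : 'rV[int]_n -> int, forall v,
    f v * form b b = 2 * form v b /\ (is_root C v -> is_root C (v - f v *: b)).
Proof.
elim=> [i|i {}b rb [f fP]].
  exists (pairing i) => v; split; last exact: root_refl.
  by rewrite !form_sroot pairing_sroot; ring.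
(* The coroot of s_i b is the coroot of b composed with s_i. *)
exists (f \o srefl C i) => v /=; have [fv rv] := fP (srefl C i v); split.
  by rewrite form_srefl fv -(form_srefl i) sreflK.
move=> /(root_refl i)/rv/(root_refl i).
by rewrite sreflB sreflK.
Qed.

Lemma root_opp b : is_root C b -> is_root C (- b).
Proof.
move=> rb; have [f /(_ b) [fb /(_ rb)]] := root_reflection b rb.
have bb := form_gt0 b (root_neq0 b rb).
(* Hence the reflection in b sends b to b - 2b = -b. *)
have -> : f b = 2 by apply/(mulIf (lt0r_neq0 bb)).
by congr is_root; apply/rowP => j; rewrite !mxE; ring.
Qed.

(* If both Cartan integers were at most -2, then (a, a) and (b, b) would be at
   most -(a, b), so that (a + b, a + b) <= 0. *)
Lemma root_add a b : is_root C a -> is_root C b -> form a b < 0 ->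
  a + b != 0 -> is_root C (a + b).
Proof.
move=> ra rb ab_lt0 ab0.
have [f /(_ b) [fb /(_ rb) rfb]] := root_reflection a ra.
have [g /(_ a) [ga /(_ ra) rga]] := root_reflection b rb.
have aa := form_gt0 a (root_neq0 a ra).
have bb := form_gt0 b (root_neq0 b rb).
have := form_gt0 _ ab0; rewrite formDl !formDr [form b a]formC => ab_gt0.
rewrite [form b a]formC in fb.
(* If a Cartan integer is -1, the corresponding reflection sends one root to a + b. *)
have [f1|f1] := eqVneq (f b) (-1).
  by move: rfb; rewrite f1 scaleN1r opprK addrC.
have [g1|g1] := eqVneq (g a) (-1).
  by move: rga; rewrite g1 scaleN1r opprK.
have f2 : f b <= -2 by nia.
have g2 : g a <= -2 by nia.
nia.
Qed.

Lemma root_sub a b : is_root C a -> is_root C b -> 0 < form a b ->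
  a != b -> is_root C (a - b).
Proof.
move=> ra rb ab_gt0 ab; apply: root_add => //; first exact: root_opp.
  by rewrite formNr oppr_lt0.
by rewrite subr_eq0.
Qed.

(** Since (u, u) is the sum of the u_i (alpha_i, u) and is positive, some term is positive; as u_i
    >= 0, both its factors are. *)
Lemma form_gt0_support u : leR 0 u -> u != 0 ->
  exists i, 0 < u 0 i /\ 0 < form u (sroot i).
Proof.
move=> u_ge0 /form_gt0; rewrite {1}(row_sum_delta u) form_suml => upos.
have [i /andP [ui fi]|no] :=
  pickP [pred i | (0 < u 0 i) && (0 < form u (sroot i))].
  by exists i.
suff : \sum_i form (u 0 i *: delta_mx 0 i) u <= 0 by rewrite leNgt upos.
apply: sumr_le0 => i _; rewrite formZl formC.
have := no i; have := u_ge0 i; rewrite mxE /= le0r => /orP [/eqP ->|ui].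
  by rewrite mul0r.
by rewrite ui /= => /negbT; rewrite -leNgt; apply/mulr_ge0_le0/ltW.
Qed.

(** Both [b] and [g] vary in the induction on the height [m]. The index [p0] makes the family
    nonempty: an empty sum is 0, which is not a root. *)
Lemma sum_le_root_extend (I : finType) (p0 : I) m :
  forall (b : I -> 'rV[int]_n) g,
  (forall p, pos_root C (b p)) -> is_root C g -> leR (\sum_p b p) g ->
  \sum_i (g - \sum_p b p) 0 i = m%:Z ->
  exists b' : I -> 'rV[int]_n,
    [/\ forall p, pos_root C (b' p), forall p, leR (b p) (b' p)
      & is_root C (\sum_p b' p)].
Proof.
elim: m => [|m IHm] b g rb rg bg; set mu := g - _ => ht_mu.
all: have mu_ge0 : leR 0 mu by move=> i; have := bg i; rewrite !mxE subr_ge0.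
all: have [mu0|mu_neq0] := eqVneq mu 0.
(* If mu = 0, the sum is already the root [g]. In the next two cases the height of mu contradicts mu
   <> 0 or mu = 0. *)
- exists b; split=> [//|p i //|].
  by move/eqP: mu0; rewrite subr_eq0 => /eqP <-.
- case/rV0Pn: mu_neq0 => i; rewrite (psumr_eq0P _ ht_mu) ?eqxx // => j _.
  by have := mu_ge0 j; rewrite mxE.
- by move: ht_mu; rewrite mu0 big1 // => i _; rewrite mxE.
have [i [mui mu_ai]] := form_gt0_support mu mu_ge0 mu_neq0.
have muE j : mu 0 j = g 0 j - (\sum_p b p) 0 j.
  by rewrite [LHS]mxE [X in _ + X]mxE.
(* By integrality mu_i >= 1, so moving by alpha_i keeps the sum below the root. *)
have le_mu j : (sroot i) 0 j <= mu 0 j.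
  rewrite mxE eqxx /=; case: eqP => [->|_]; first lia.
  by have := mu_ge0 j; rewrite mxE.
have ht_step : \sum_j (mu - sroot i) 0 j = m%:Z.
  have -> : \sum_j (mu - sroot i) 0 j = \sum_j (mu 0 j - sroot i 0 j).
    by apply: eq_bigr => j _; rewrite [LHS]mxE [X in _ + X]mxE.
  rewrite sumrB ht_mu (bigD1 i) //= big1 ?mxE ?eqxx => [|j /negPf ji].
    by lia.
  by rewrite mxE ji andbF.
have b_ge0 p j : 0 <= b p 0 j by have := proj2 (rb p) j; rewrite mxE.
have b_le p j : b p 0 j <= (\sum_q b q) 0 j.
  by rewrite summxE (bigD1 p) //= lerDl sumr_ge0.
have [g_ai|g_ai] := ltP 0 (form g (sroot i)).
  apply: (IHm b (g - sroot i)) => //; last by rewrite addrAC.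
    apply: root_sub => //; first exact: root_simple.
    (* If g = alpha_i, then alpha_i <= mu forces the sum to be <= 0, hence b_p0 = 0. *)
    apply: contraNneq (root_neq0 _ (proj1 (rb p0))) => gi.
    apply/eqP/rowP => j; rewrite [RHS]mxE; apply: le_anti.
    rewrite b_ge0 andbT (le_trans (b_le p0 j)) //.
    by have := le_mu j; rewrite muE gi lerBrDr gerDl.
  move=> j; rewrite [leRHS]mxE [X in _ + X]mxE.
  by have := le_mu j; rewrite muE !lerBrDr addrC.
(* Here (g, alpha_i) <= 0 < (mu, alpha_i), so the (b_p, alpha_i) have negative sum. *)
have [p b_ai] : exists p, form (b p) (sroot i) < 0.
  have [p b_ai|no] := pickP (fun p => form (b p) (sroot i) < 0).
    by exists p.
  have : 0 <= \sum_p form (b p) (sroot i).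
    by apply: sumr_ge0 => p _; rewrite leNgt no.
  by move: mu_ai; rewrite /mu formDl formNl form_suml; lia.
pose b1 q := if q == p then b p + sroot i else b q.
have sum_b1 : \sum_q b1 q = \sum_q b q + sroot i.
  rewrite (bigD1 p) //= [in RHS](bigD1 p) //= /b1 eqxx addrAC; congr (_ + _ + _).
  by apply: eq_bigr => q /negPf ->.
have b_le_b1 q : leR (b q) (b1 q).
  move=> j; rewrite /b1; case: eqP => [->|_] //.
  by rewrite [X in _ <= X]mxE lerDl mxE; case: (_ && _).
have [|//|||b' [rb' b1_le rsum]] := IHm b1 g.
- move=> q; split; last by move=> j; rewrite mxE (le_trans _ (b_le_b1 q j)).
  rewrite /b1; case: eqP => [_|_]; last by case: (rb q).
  apply: root_add => //; [by case: (rb p) | exact: root_simple |].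
  (* The i-th coordinate of b_p + alpha_i is at least 1. *)
  apply/rV0Pn; exists i; rewrite mxE [sroot i _ _]mxE !eqxx.
  by rewrite lt0r_neq0 // ltr_wpDl.
- move=> j; rewrite sum_b1 [leLHS]mxE.
  by have := le_mu j; rewrite muE lerBrDr addrC.
- by rewrite sum_b1 opprD addrA.
exists b'; split=> // q j; exact: le_trans (b_le_b1 q j) (b1_le q j).
Qed.

End Form.

Theorem theorem1p5 (n : nat) (C : 'M[int]_n) (theta : 'rV[int]_n)
  (A : 'rV[int]_n -> Prop) (k : nat) :
  simple_cartan C -> highest_root C theta -> antichain C A -> (1 <= k)%N ->
  (nilpotence C (PhiI C A) k <->
   forall b : 'I_k.+1 -> 'rV[int]_n, (forall p, A (b p)) ->
     ~ leR (\sum_p b p) theta).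
Proof.
move=> [_ [C2 _ _] _ [d symC]] [[rtheta _] theta_max] [A_pos _] _; split.
  move=> nilp b Ab b_theta.
  have b_pos p : pos_root C (b p) by apply: A_pos.
  have mu_ge0 i : true -> 0 <= (theta - \sum_p b p) 0 i.
    by move=> _; have := b_theta i; rewrite !mxE subr_ge0.
  (* The height of theta minus the sum is nonnegative, so its absolute value serves as [m]. *)
  have [b' [b'_pos b_le rsum]] := sum_le_root_extend n C d C2 symC _ ord0
    _ b theta b_pos rtheta b_theta (esym (gez0_abs (sumr_ge0 _ mu_ge0))).
  by apply: nilp rsum => p; split=> //; exists (b p).
move=> not_le b Phib rsum.
(* Choose c_p in [A] below each b_p: the sum of the c_p is below that of the b_p, a positive root
   and so at most theta. *)
have [c cP] : exists c : 'I_k.+1 -> 'rV[int]_n,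
    forall p, A (c p) /\ leR (c p) (b p).
  apply: (@fin_all_exists _ (fun=> _) (fun p a => A a /\ leR a (b p))) => p.
  by have [_] := Phib p.
apply: (not_le c) => [p|i]; first by case: (cP p).
apply: (@le_trans _ _ ((\sum_p b p) 0 i)).
  by rewrite !summxE; apply: ler_sum => p _; case: (cP p).
apply: theta_max; split=> // j; rewrite mxE summxE; apply: sumr_ge0 => p _.
by have [[_ /(_ j)]] := Phib p; rewrite mxE.
Qed.
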